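(* Let $H$ be a Steiner triple system on $N\ge7$ points, that is, a $3$-uniform hypergraph on $N$ vertices in which every pair of vertices lies in exactly one edge. Then $\lambda(H)=(N-1)/2$, and for every prime power $q$, $\mathcal C_H$ is an $\bigl[N(N-1)/6,\ (N-1)/2,\ (N-1)/2\bigr]_q^2$ code with $d^\perp(\mathcal C_H)=3$. It attains the bound $k\ge hd$, which holds for every faithful hypergraphic additive code over $\mathbb F_{q^h}$ of $\mathbb F_q$-dimension $k$ and minimum distance $d$ that has a connected underlying hypergraph and dual distance at least $3$; that is, $\dim_{\mathbb F_q}\mathcal C_H=2\,d(\mathcal C_H)$.
   Context: A finite hypergraph is a triple $H=(V,\mathcal E,\psi_H)$ with finite sets $V$, $\mathcal E$ and a map $\psi_H:\mathcal E\to2^V\setminus\{\emptyset\}$; $e$ is identified with $\psi_H(e)$. It is $r$-uniform if $|e|=r$ for all edges, and connected if any two vertices are joined by a walk $u_0,e_1,u_1,\ldots,e_\ell,u_\ell$ with $u_{i-1},u_i\in e_i$. For $\emptyset\ne S\subsetneq V$, $\delta_H(S)$ is the set of edges meeting both $S$ and $V\setminus S$; $\lambda(H):=\min_{\emptyset\ne S\subsetneq V}|\delta_H(S)|$. For $A\subseteq\mathcal E$, $f_H(A):=|V|-\kappa(A)$, where $\kappa(A)$ is the number of connected components of $(V,A,\psi_H|_A)$, isolated vertices included. Code $\mathcal C_H$ of an $r$-uniform $H$ (here $r=3$, $h=r-1=2$): fix for each edge an ordering $e=(v_{e,1},\ldots,v_{e,r})$ and an $\mathbb F_q$-linear bijection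 $\iota:\mathbb F_q^h\to\mathbb F_{q^h}$. For $a:V\to\mathbb F_q$ let $\Phi_H(a):=\bigl(\iota\bigl((a(v_{e,j})-a(v_{e,1}))_{2\le j\le r}\bigr)\bigr)_{e\in\mathcal E}\in\mathbb F_{q^h}^{|\mathcal E|}$, and $\mathcal C_H:=\operatorname{Im}(\Phi_H)$. An additive code is an $\mathbb F_q$-subspace $\mathcal C\subseteq\mathbb F_{q^h}^n$. An $[n,k/h,d]_q^h$ code is one of $\mathbb F_q$-dimension $k$ with minimum nonzero Hamming weight $d$. It is faithful if every coordinate map $\mathcal C\to\mathbb F_{q^h}$ is surjective. It is hypergraphic with underlying hypergraph $H$ (with edge set the coordinate set) if no coordinate is identically zero and for every set $A$ of coordinates $k-\dim_{\mathbb F_q}\{c\in\mathcal C:c|_A=0\}=f_H(A)$. Dual distance: let $\widetilde{\mathcal C}\subseteq(\mathbb F_q^h)^n=\mathbb F_q^{hn}$ be the image of $\mathcal C$ under coordinatewise expansion with respect to a fixed $\mathbb F_q$-basis of $\mathbb F_{q^h}$, and $\widetilde{\mathcal C}^\perp$ its dual for the standard inner product. Then $d^\perp(\mathcal C):=\min\{|\{i:x_i\ne0\}|:0\ne x=(x_1,\ldots,x_n)\in\widetilde{\mathcal C}^\perp\}$ with $x_i\in\mathbb F_q^h$, and $\infty$ if $\widetilde{\mathcal C}^\perp=0$. *)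

(* Defs.v *)
From HB Require Import structures.
From mathcomp Require Import all_boot all_order all_algebra all_field.
From mathcomp Require Import constructive_ereal.

Set Implicit Arguments.
Unset Strict Implicit.
Unset Printing Implicit Defensive.

Import Order.TTheory GRing.Theory Num.Theory.
Local Open Scope ring_scope.

(* Minima of cardinalities live in [\bar rat], so that a minimum over the     *)
(* empty family is +oo.                                                       *)
Definition enat (n : nat) : \bar rat := (n%:R)%:E.

(** * Hypergraphs *)

(* Distinct edges may have the same set of ends. *)
Record hypergraph (V E : finType) := Hypergraph {
  ends :> E -> {set V};
  ends_neq0 : forall e, ends e != set0
}.

Section Hypergraph.
Variables (V E : finType) (H : hypergraph V E).
Implicit Types (A : {set E}) (S : {set V}).

Definition uniform (r : nat) : Prop := forall e, #|H e| = r.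

Definition hadj A : rel V :=
  [rel u v | [exists e in A, (u \in H e) && (v \in H e)]].

Definition hconnected : Prop := forall u v, connect (hadj [set: E]) u v.

Definition ncomponents A : nat := n_comp (hadj A) [set: V].

(* No truncation occurs, since there are at most #|V| components. *)
Definition hrank A : nat := (#|V| - ncomponents A)%N.

Definition cut S : {set E} :=
  [set e | (H e :&: S != set0) && (H e :&: ~: S != set0)].

Definition edge_connectivity : \bar rat :=
  \big[Order.min/+oo%E]_(S : {set V} | (S != set0) && (S \proper [set: V]))
     enat #|cut S|.

Definition steiner_triple_system : Prop :=
  uniform 3 /\
  forall u v : V, u != v -> exists! e, (u \in H e) && (v \in H e).

Definition edge_ordering r (ord : E -> r.-tuple V) : Prop :=
  forall e, uniq (ord e) /\ [set v in ord e] = H e.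

End Hypergraph.

(** * Codes of length #|E| whose coordinates are indexed by E *)

Definition hweight (E : finType) (T : zmodType) (c : {ffun E -> T}) : nat :=
  #|[set e | c e != 0]|.

(* [finvect_type W] is W itself, seen as a finite type. *)
Definition min_weight (F : finFieldType) (E : finType) (T : vectType F)
    (P : pred {ffun E -> T}) : \bar rat :=
  \big[Order.min/+oo%E]_(c : finvect_type {ffun E -> T} | P c && (c != 0))
     enat (hweight (c : {ffun E -> T})).

Section AdditiveCode.
Variables (F : finFieldType) (L : fieldExtType F) (E : finType).
Implicit Types (C : {vspace {ffun E -> L}}) (A : {set E}).

Definition min_distance C : \bar rat := min_weight (fun c => c \in C).

(* [n, k/h, d]_q^h, where q = #|F|, h = \dim {:L} and kappa stands for k/h. *)
Definition additive_code_params C (n kappa d : rat) : Prop :=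
  [/\ #|E|%:R = n,
      (\dim C)%:R / (\dim {:L})%:R = kappa
    & min_distance C = d%:E].

Definition faithful_code C : Prop :=
  forall (e : E) (x : L), exists2 c, c \in C & c e = x.

Definition code_coord (e : E) (c : {ffun E -> L}) : L := c e.

Fact code_coord_is_linear e : linear (code_coord e).
Proof. by move=> a u v; rewrite /code_coord !ffunE. Qed.

HB.instance Definition _ e :=
  GRing.isLinear.Build F {ffun E -> L} L *:%R (code_coord e)
    (code_coord_is_linear e).

Definition vanishing C A : {vspace {ffun E -> L}} :=
  (C :&: \bigcap_(e in A) lker (linfun (code_coord e)))%VS.

Lemma mem_vanishing C A c :
  (c \in vanishing C A) = (c \in C) && [forall e in A, c e == 0].
Proof.
rewrite /vanishing memv_cap; congr (_ && _); rewrite memvE.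
apply/subv_bigcapP/forall_inP => sub e /sub.
  by rewrite -memvE memv_ker lfunE.
by rewrite -memvE memv_ker lfunE.
Qed.

Definition hypergraphic_code (V : finType) (H : hypergraph V E) C : Prop :=
  (forall e : E, exists2 c, c \in C & c e != 0) /\
  (forall A : {set E}, (\dim C - \dim (vanishing C A))%N = hrank H A).

Section Dual.
Variables (h : nat) (b : h.-tuple L).

(* Meaningful when b is a basis of L over F. *)
Definition expansion (c : {ffun E -> L}) : {ffun E -> 'rV[F]_h} :=
  [ffun e => \row_j coord b j (c e)].

Definition inner_product (x y : {ffun E -> 'rV[F]_h}) : F :=
  \sum_e \sum_j x e 0 j * y e 0 j.

Definition dual_word C (x : {ffun E -> 'rV[F]_h}) : bool :=
  [forall c : finvect_type {ffun E -> L},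
    (c \in C) ==> (inner_product x (expansion c) == 0)].

Definition dual_distance C : \bar rat := min_weight (dual_word C).

End Dual.
End AdditiveCode.

(** * The code of a uniform hypergraph *)

(* The hypergraph enters through the chosen orderings [ord] of its edges. *)
Section HypergraphCode.
Variables (F : finFieldType) (L : fieldExtType F) (V E : finType) (h : nat).
Variables (ord : E -> h.+1.-tuple V) (iota : {linear 'rV[F]_h -> L}).

Definition hcode_map (a : {ffun V -> F^o}) : {ffun E -> L} :=
  [ffun e => iota (\row_(j < h)
     (a (tnth (ord e) (lift ord0 j)) - a (tnth (ord e) ord0)))].

Fact hcode_map_is_linear : linear hcode_map.
Proof.
move=> k a a'; apply/ffunP => e; rewrite !ffunE -linearP; congr (iota _).
apply/rowP => j; rewrite !mxE !ffunE /GRing.scale /=.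
by rewrite mulrBr addrACA opprD.
Qed.

HB.instance Definition _ :=
  GRing.isLinear.Build F {ffun V -> F^o} {ffun E -> L} *:%R hcode_map
    hcode_map_is_linear.

Definition hypergraph_code : {vspace {ffun E -> L}} := limg (linfun hcode_map).

Lemma mem_hypergraph_code c :
  reflect (exists a, c = hcode_map a) (c \in hypergraph_code).
Proof.
apply: (iffP memv_imgP) => [[a _ ->]|[a ->]]; exists a; rewrite ?lfunE //.
exact: memvf.
Qed.

End HypergraphCode.

(* Main.v *)
(* For a proper nonempty S, a codeword supported on the cut of S exists, and  *)
(* every nonzero codeword of C_H, seen as a function on the vertices, is      *)
(* nonzero on the cut of one of its level sets; so d(C_H) = lambda(H). In a   *)
(* Steiner triple system every edge cut by S carries exactly two pairs of     *)
(* S x (V - S), so 2 |cut S| = |S| (N - |S|), which is minimal at singletons. *)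
(* Two edges meet in at most one point, hence no dual word has weight at most *)
(* 2, while the three sides of a triangle have rank at most 5 < 6 and so      *)
(* carry a dual word.                                                         *)
(* For the bound k >= h d: a faithful hypergraphic code has all edges of size *)
(* h + 1, dual distance at least 3 makes the hypergraph linear, so a vertex   *)
(* has degree at most (|V| - 1) / h = k / h, and the edges at a vertex form a *)
(* cut.                                                                       *)

Require Import Defs.
From HB Require Import structures.
From mathcomp Require Import all_boot all_order all_algebra all_field.
From mathcomp Require Import constructive_ereal zify.

Set Implicit Arguments.
Unset Strict Implicit.
Unset Printing Implicit Defensive.

Import Order.TTheory GRing.Theory Num.Theory.
Local Open Scope ring_scope.

(** * Hypergraph rank and cuts *)

(** A coordinate of [hcode_map a] vanishes exactly when [a] is constant on that edge
    ([hcode_map_eq0]). So the words of [hypergraph_code] vanishing on [A] come from the functions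
    constant on the components of [A], which makes the code hypergraphic
    ([dim_vanishing_hypergraph_code]), and for connected [H] its minimum distance is the edge
    connectivity ([min_distance_hypergraph_code]). In a Steiner triple system [sts_card_cut] reduces
    cuts to the product |S|(N-|S|), whence d = (N-1)/2, while the dimension is N-1 = 2d.

    Dual words come from rank: [dual_distance_le_rank] finds one supported in any [A] whose rank is
    below h|A|. With [sts_triangle] this gives dual distance at most 3; [dual_distance_linear_ge]
    gives the converse. In the general bound the same lemma forces distinct edges to meet in at most
    one vertex ([dual_distance_ge3_linear]); then [degree_linear] bounds a vertex degree by k/h, and
    [min_distance_le_cut] bounds d by that degree. *)

Lemma enat_le m n : (enat m <= enat n)%E = (m <= n)%N.
Proof. by rewrite lee_fin ler_nat. Qed.

Lemma connect_inv (T : finType) (X : Type) (r : rel T) (f : T -> X) :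
  (forall u v, r u v -> f u = f v) -> forall u v, connect r u v -> f u = f v.
Proof.
move=> rf u v /connectP[p]; elim: p u => [u _ -> //|w p IH u /=].
by case/andP=> /rf -> /IH.
Qed.

Section Hypergraph.
Variables (V E : finType) (H : hypergraph V E).
Implicit Types (A : {set E}) (S U : {set V}).

Lemma edge_connectivity_le S :
  S != set0 -> S \proper setT -> (edge_connectivity H <= enat #|cut H S|)%E.
Proof. by move=> S0 ST; apply: bigmin_le_cond; rewrite S0. Qed.

Lemma edge_connectivity_ge x :
  (forall S, S != set0 -> S \proper setT -> (x <= enat #|cut H S|)%E) ->
  (x <= edge_connectivity H)%E.
Proof.
by move=> le_x; apply: le_bigmin => [|S /andP[]]; [rewrite leey | apply: le_x].
Qed.

Lemma hadjP A u v :
  reflect (exists2 e, e \in A & u \in H e /\ v \in H e) (hadj H A u v).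
Proof.
apply: (iffP exists_inP) => -[e eA].
  by case/andP=> ue ve; exists e.
by case=> ue ve; exists e; rewrite // ue.
Qed.

Lemma hadj_sym A : symmetric (hadj H A).
Proof. by move=> u v; apply: eq_existsb => e; rewrite (andbC (u \in _)). Qed.

Lemma hadj_connect_sym A : connect_sym (hadj H A).
Proof. exact/sym_connect_sym/hadj_sym. Qed.

Lemma connect_hadj_inv (T : Type) A (f : V -> T) u v :
  (forall e, e \in A -> {in H e &, forall x y, f x = f y}) ->
  connect (hadj H A) u v -> f u = f v.
Proof.
by move=> fA; apply: connect_inv => x y /hadjP[e eA []]; apply: fA.
Qed.

Lemma ncomponents_connected : hconnected H -> (0 < #|V|)%N ->
  ncomponents H setT = 1%N.
Proof.
move=> Hc /card_gt0P[v _]; apply/eqP; rewrite eqn_leq; apply/andP; split.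
  apply/card_le1_eqP => x y; rewrite !inE !andbT => /eqP <- /eqP <-.
  exact/(fingraph.rootP (hadj_connect_sym _))/Hc.
apply/card_gt0P; exists (fingraph.root (hadj H setT) v).
by rewrite inE roots_root ?inE //; apply: hadj_connect_sym.
Qed.

Lemma hrank_connected : hconnected H -> hrank H setT = #|V|.-1.
Proof.
rewrite /hrank; case: (posnP #|V|) => [->//|V0 connH].
by rewrite ncomponents_connected // subn1.
Qed.

(** Vertices outside [U] are isolated in the subhypergraph [A], and [U] contributes at least one
    further component. *)
Lemma hrank_le A U : U != set0 -> (forall e, e \in A -> H e \subset U) ->
  (hrank H A <= #|U|.-1)%N.
Proof.
case/set0Pn=> u uU sAU.
have csym := hadj_connect_sym A.
suff: (#|~: U| < ncomponents H A)%N.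
  have : (0 < #|U|)%N by apply/card_gt0P; exists u.
  by rewrite /hrank -(cardsC U); lia.
have UA w : (w \in U) = (fingraph.root (hadj H A) w \in U).
  apply: (connect_hadj_inv (A := A) (f := fun w => w \in U)); last exact: connect_root.
  by move=> e /sAU /subsetP sU x y /sU -> /sU ->.
have rU : fingraph.root (hadj H A) u \in U by rewrite -UA.
(* The representative of [u] lies in [U] and each vertex outside [U] is its own representative, so
   these are distinct roots. *)
rewrite (@leq_trans #|fingraph.root (hadj H A) u |: ~: U|) //.
  by rewrite cardsU1 inE rU.
apply/subset_leq_card/subsetP => w; rewrite !inE andbT => /orP[/eqP->|wU].
  exact: roots_root.
apply/eqP; apply: contraNeq wU => rw.
have: connect (hadj H A) w (fingraph.root (hadj H A) w) by exact: connect_root.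
case/connectP=> [[|x p] /=]; first by move=> _ e; rewrite e eqxx in rw.
by case/andP=> /hadjP[e eA [we _]] _ _; apply: (subsetP (sAU e eA)).
Qed.

Lemma hrank1 e : hrank H [set e] = #|H e|.-1.
Proof.
apply/eqP; rewrite eqn_leq hrank_le ?ends_neq0 //=; last first.
  by move=> f /set1P->.
have [u ue] := set0Pn _ (ends_neq0 H e).
have: (ncomponents H [set e] <= #|~: H e|.+1)%N.
  apply: (@leq_trans #|fingraph.root (hadj H [set e]) u |: ~: H e|); last first.
    by rewrite cardsU1 -add1n leq_add2r leq_b1.
  apply/subset_leq_card/subsetP => w; rewrite !inE andbT => rw.
  have [we|] := boolP (w \in H e); last by rewrite orbT.
  rewrite orbF -(eqP rw); apply/eqP/(fingraph.rootP (hadj_connect_sym _))/connect1.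
  by apply/hadjP; exists e; rewrite ?inE.
have He0 : (0 < #|H e|)%N by rewrite card_gt0 ends_neq0.
by rewrite /hrank -(cardsC (H e)); lia.
Qed.

(** No uncut edge joins [S] to its complement, so at least two components remain. *)
Lemma hrank_cut S :
  S != set0 -> S \proper setT -> (hrank H (~: cut H S) <= #|V|.-2)%N.
Proof.
case/set0Pn=> u uS /properP[_ [v _ vS]].
set A := ~: _; have csym := hadj_connect_sym A.
suff: (1 < ncomponents H A)%N.
  rewrite /hrank => k2; apply: leq_trans (leq_sub2l _ k2) _.
  by rewrite -subn2.
rewrite ltnNge; apply/card_le1_eqP => /(_ (fingraph.root (hadj H A) u) (fingraph.root (hadj H A) v)).
rewrite !inE !roots_root // => /(_ isT isT) /eqP; rewrite root_connect // => vu.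
suff: (v \in S) = (u \in S) by rewrite uS (negPf vS).
apply: (connect_hadj_inv (f := fun w => w \in S) _ vu) => e eA x y xe ye.
apply/idP/idP=> zS; apply/idPn=> zNS; move: eA; rewrite !inE => /negP[];
  apply/andP; split; apply/set0Pn.
- by exists x; rewrite inE xe.
- by exists y; rewrite !inE ye.
- by exists y; rewrite inE ye.
- by exists x; rewrite !inE xe.
Qed.

Lemma cut1 v : (forall e, (1 < #|H e|)%N) -> cut H [set v] = [set e | v \in H e].
Proof.
move=> He; apply/setP => e; rewrite !inE.
have -> : (H e :&: [set v] != set0) = (v \in H e).
  apply/set0Pn/idP => [[w]|ve]; first by rewrite !inE => /andP[we /eqP <-].
  by exists v; rewrite !inE ve eqxx.
case: (boolP (v \in H e)) => //= ve; apply/set0Pn.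
have /card_gt0P[w] : (0 < #|H e :\ v|)%N.
  by have := He e; rewrite (cardsD1 v) ve.
by rewrite !inE => /andP[wv we]; exists w; rewrite !inE we.
Qed.

(** Double counting of pairs (e, u) with e through [v] and u another vertex of e: each e contributes
    [h], and each u occurs at most once, since two edges through u and [v] would meet twice. *)
Lemma degree_linear h v :
  (forall e, #|H e| = h.+1) ->
  (forall e f, e != f -> (#|H e :&: H f| <= 1)%N) ->
  (h * #|[set e | v \in H e]| <= #|V|.-1)%N.
Proof.
move=> Hh Hlin.
have -> : (h * #|[set e | v \in H e]|)%N =
    (\sum_(e in [set e | v \in H e]) \sum_(u in [set~ v]) (u \in H e))%N.
  rewrite mulnC -sum_nat_const; apply: eq_bigr => e; rewrite inE => ve.
  rewrite -big_mkcondr /= sum1_card -[h]/(h.+1.-1) -(Hh e) (cardsD1 v) ve /=.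
  by rewrite add0n; apply: eq_card => u; rewrite [RHS]unfold_in !inE.
have -> : #|V|.-1 = (\sum_(u in [set~ v]) 1)%N by rewrite sum1_card cardsC1.
rewrite exchange_big; apply: leq_sum => u; rewrite !inE => uv.
rewrite -big_mkcondr sum1_card; apply/card_le1_eqP => e f.
move=> /andP[/[!inE] ve ue] /andP[/[!inE] vf uf]; apply/eqP/idPn=> ef.
have := Hlin _ _ ef; rewrite leqNgt => /negP[].
by rewrite (cardsD1 v) !inE ve vf (cardsD1 u) !inE uv ue uf.
Qed.

End Hypergraph.

(** * Steiner triple systems *)

Section Steiner.
Variables (V E : finType) (H : hypergraph V E).
Hypothesis stsH : steiner_triple_system H.
Implicit Types (S : {set V}).

Lemma sts_card e : #|H e| = 3%N. Proof. by case: stsH. Qed.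

Lemma sts_edge u v : u != v -> exists e, u \in H e /\ v \in H e.
Proof. by case: stsH => _ /[apply] -[e [/andP[ue ve] _]]; exists e. Qed.

Lemma sts_edge_inj u v e f : u != v ->
  u \in H e -> v \in H e -> u \in H f -> v \in H f -> e = f.
Proof.
case: stsH => _ sts /sts[g [_ gP]] ue ve uf vf.
by rewrite -(gP e) ?ue // -(gP f) ?uf.
Qed.

Lemma sts_linear e f : e != f -> (#|H e :&: H f| <= 1)%N.
Proof.
move=> ef; apply/card_le1_eqP => u v /setIP[ue uf] /setIP[ve vf].
by apply/eqP; apply: contraNT ef => uv; apply/eqP/(sts_edge_inj uv).
Qed.

Lemma sts_connected : hconnected H.
Proof.
move=> u v; have [->|/sts_edge[e [ue ve]]] := eqVneq u v; first exact: connect0.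
by apply/connect1/hadjP; exists e; rewrite ?inE.
Qed.

(* An edge in the cut splits as 1 + 2, so it contains exactly two of the      *)
(* pairs (u, v) with u in S and v outside S.                                  *)
Lemma sts_card_cut S : (2 * #|cut H S| = #|S| * #|~: S|)%N.
Proof.
have -> : (2 * #|cut H S| = \sum_e #|H e :&: S| * #|H e :&: ~: S|)%N.
  rewrite mulnC -sum_nat_const big_mkcond; apply: eq_bigr => e _.
  have := cardsID S (H e); rewrite setDE sts_card inE -!card_gt0.
  by case: #|H e :&: S| #|H e :&: ~: S| => [|[|[|[|a]]]] [|[|[|[|b]]]].
have memI e T : (#|H e :&: T| = \sum_(u in T) (u \in H e))%N.
  by rewrite -big_mkcondr sum1_card; apply: eq_card => u; rewrite !inE andbC.
under eq_bigr do rewrite !memI big_distrlr /=.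
rewrite exchange_big /= -sum_nat_const; apply: eq_bigr => u uS.
rewrite exchange_big /= -sum1_card; apply: eq_bigr => v; rewrite inE => vS.
have uv : u != v by apply: contraNneq vS => <-.
have [e [ue ve]] := sts_edge uv.
rewrite (bigD1 e) //= ue ve big1 // => f fe.
case uf: (u \in H f); case vf: (v \in H f) => //.
by rewrite (sts_edge_inj uv uf vf ue ve) eqxx in fe.
Qed.

Lemma sts_degree v : (2 * #|cut H [set v]| = #|V|.-1)%N.
Proof. by rewrite sts_card_cut cards1 mul1n cardsC1. Qed.

(** The degrees, each (N-1)/2, add up to three times the number of edges. *)
Lemma sts_card_edges : (6 * #|E| = #|V| * #|V|.-1)%N.
Proof.
have -> : (#|V| * #|V|.-1 = \sum_v 2 * #|cut H [set v]|)%N.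
  by rewrite -sum_nat_const; apply: eq_bigr => v _; rewrite sts_degree.
rewrite -big_distrr /= (_ : (\sum_v _ = 3 * #|E|)%N) ?mulnA //.
transitivity (\sum_v \sum_e (v \in H e))%N.
  apply: eq_bigr => v _; rewrite cut1 => [|e]; last by rewrite sts_card.
  by rewrite -sum1_card big_mkcond; apply: eq_bigr => e _; rewrite inE.
rewrite exchange_big /= mulnC -sum_nat_const; apply: eq_bigr => e _.
by rewrite -[RHS](sts_card e) -sum1_card [RHS]big_mkcond.
Qed.

(** With s = |S| and N = |V|, [sts_card_cut] turns this into N-1 <= s(N-s), that is 0 <=
    (s-1)(N-s-1). *)
Lemma sts_cut_min S v : S != set0 -> S \proper setT ->
  (#|cut H [set v]| <= #|cut H S|)%N.
Proof.
rewrite -card_gt0 => S0 /proper_card; rewrite cardsT -(cardsC S).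
have := sts_card_cut S; have := sts_degree v; rewrite -(cardsC S); nia.
Qed.

Lemma sts_edge_connectivity v : (1 < #|V|)%N ->
  edge_connectivity H = enat #|cut H [set v]|.
Proof.
move=> V1; have v0 : [set v] != set0 by rewrite -card_gt0 cards1.
have vT : [set v] \proper setT by rewrite properEcard subsetT cards1 cardsT.
apply/le_anti; rewrite edge_connectivity_le //=.
by apply: edge_connectivity_ge => S S0 ST; rewrite enat_le sts_cut_min.
Qed.

End Steiner.

(* The sides of a triangle span at most six points. *)
Lemma sts_triangle (V E : finType) (H : hypergraph V E) :
  steiner_triple_system H -> (3 < #|V|)%N ->
  exists2 A : {set E}, #|A| = 3%N & (hrank H A <= 5)%N.
Proof.
move=> sts V3; have E3 := sts_card sts.
have /card_gt1P[u [v [_ _ uv]]] : (1 < #|V|)%N by apply: leq_trans V3.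
have [e [ue ve]] := sts_edge sts uv.
have /subsetPn[w _ we] : ~~ (setT \subset H e).
  by apply: contraTN V3 => /subset_leq_card; rewrite cardsT E3 -leqNgt.
have uw : u != w by apply: contraNneq we => <-.
have vw : v != w by apply: contraNneq we => <-.
have [f [uf wf]] := sts_edge sts uw; have [g [vg wg]] := sts_edge sts vw.
have ef : e != f by apply: contraNneq we => ->.
have eg : e != g by apply: contraNneq we => ->.
have fg : f != g.
  by apply: contraNneq ef => fg; apply/eqP/(sts_edge_inj sts uv); rewrite // fg.
exists (e |: [set f; g]); first by rewrite cardsU1 cards2 !inE negb_or ef eg fg.
apply: leq_trans (hrank_le (U := H e :|: H f :|: H g) _ _) _.
- by apply/set0Pn; exists u; rewrite !inE ue.
- move=> x; rewrite !inE => /or3P[] /eqP->; rewrite ?subsetUr //.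
    by rewrite -setUA subsetUl.
  by rewrite setUAC subsetUr.
(* [e] and [f] share [u], so they cover at most 5 points; [g] contains [v] and [w] among these and
   adds at most one. *)
have : (0 < #|H e :&: H f|)%N by apply/card_gt0P; exists u; rewrite inE ue.
have : (1 < #|(H e :|: H f) :&: H g|)%N.
  by apply/card_gt1P; exists v, w; rewrite !inE ve vg wf wg orbT.
have := cardsUI (H e :|: H f) (H g); have := cardsUI (H e) (H f).
rewrite !E3; lia.
Qed.

(** * Additive codes *)

Section MinWeight.
Variables (F : finFieldType) (E : finType) (T : vectType F).
Variable P : pred {ffun E -> T}.

Lemma min_weight_le c : P c -> c != 0 -> (min_weight P <= enat (hweight c))%E.
Proof.
move=> Pc c0; apply: (bigmin_le_cond _ (j := c : finvect_type {ffun E -> T})).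
by rewrite Pc.
Qed.

Lemma min_weight_ge x :
  (forall c, P c -> c != 0 -> (x <= enat (hweight c))%E) -> (x <= min_weight P)%E.
Proof.
by move=> le_x; apply: le_bigmin => [|c /andP[]]; [rewrite leey | apply: le_x].
Qed.

End MinWeight.

Lemma separating_functional (K : fieldType) (T : vectType K) (W : {vspace T}) v :
  v \notin W ->
  exists2 phi : 'Hom(T, K^o), phi v != 0 & forall w, w \in W -> phi w = 0.
Proof.
move=> vW; have: v - projv W v != 0.
  by apply: contraNneq vW => /eqP; rewrite subr_eq0 => /eqP ->; apply: memv_proj.
set t := v - _ => t0.
have [i ti] : exists i, coord (vbasis fullv) i t != 0.
  apply/existsP; apply: contraNT t0 => /existsPn ti.
  rewrite (coord_vbasis (memvf t)) big1 // => i _.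
  by move/negPn/eqP: (ti i) => ->; rewrite scale0r.
exists (linfun (coord (vbasis fullv) i : T -> K^o) \o (\1 - projv W))%VF.
  by rewrite comp_lfunE lfunE /= add_lfunE opp_lfunE id_lfunE.
by move=> w wW; rewrite comp_lfunE add_lfunE opp_lfunE id_lfunE projv_id // subrr linear0.
Qed.

Section DimInvariant.
Variables (F : fieldType) (V : finType).

Definition restrict (T : vectType F) (P : pred V) (a : {ffun V -> T}) :
  {ffun {v | P v} -> T} := [ffun v => a (val v)].

Fact restrict_is_linear (T : vectType F) (P : pred V) :
  linear (@restrict T P).
Proof. by move=> k a b; apply/ffunP => v; rewrite !ffunE. Qed.

HB.instance Definition _ (T : vectType F) (P : pred V) :=
  GRing.isLinear.Build F {ffun V -> T} {ffun {v | P v} -> T} *:%R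
    (@restrict T P) (@restrict_is_linear T P).

Lemma restrict_surj (T : vectType F) (P : pred V) (a : {ffun {v | P v} -> T}) :
  restrict P [ffun v => if insub v is Some w then a w else 0] = a.
Proof. by apply/ffunP => w; rewrite !ffunE valK. Qed.

Lemma dim_ffun (T : vectType F) (I : finType) :
  \dim {: {ffun I -> T}} = (#|I| * \dim {:T})%N.
Proof. by rewrite !dimvf. Qed.

(** An invariant function is determined by its values on the component representatives, and these
    values are arbitrary: restriction to the roots is an isomorphism on [U]. *)
Lemma dim_invariant (r : rel V) (U : {vspace {ffun V -> F^o}}) :
  connect_sym r ->
  (forall a : {ffun V -> F^o}, reflect (forall u v, r u v -> a u = a v) (a \in U)) ->
  \dim U = n_comp r [set: V].
Proof.
move=> csym UP; pose rho := linfun (@restrict F^o (fingraph.roots r)).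
have Uroot (a : {ffun V -> F^o}) v : a \in U -> a v = a (fingraph.root r v).
  by move=> /UP Ua; apply: connect_inv Ua _ _ _; apply: connect_root.
rewrite -(limg_dim_eq (f := rho)); last first.
  apply/eqP; rewrite -subv0; apply/subvP => a /memv_capP[aU].
  rewrite memv_ker lfunE memv0 => /eqP/ffunP a0; apply/eqP/ffunP => v.
  rewrite (Uroot _ _ aU); have := a0 (exist (fingraph.roots r) _ (roots_root csym v)).
  by rewrite !ffunE.
have -> : (rho @: U = fullv)%VS.
  apply/eqP; rewrite eqEsubv subvf; apply/subvP => b _; apply/memv_imgP.
  pose a : {ffun V -> F^o} :=
    [ffun v => if insub v is Some w then b w else 0].
  exists [ffun v => a (fingraph.root r v)]; last first.
    rewrite lfunE -[LHS]restrict_surj; apply/ffunP => w; rewrite !ffunE.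
    by rewrite (eqP (valP w)).
  by apply/UP => u v /connect1/(fingraph.rootP csym); rewrite !ffunE => ->.
rewrite dim_ffun card_sig dimvf /= muln1.
by apply: eq_card => v; rewrite !inE andbT.
Qed.

End DimInvariant.

Section AdditiveCode.
Variables (F : finFieldType) (L : fieldExtType F) (E : finType).
Implicit Types (C : {vspace {ffun E -> L}}) (A : {set E}).

Lemma faithful_rank1 C e : faithful_code C ->
  (\dim C - \dim (vanishing C [set e]))%N = \dim {:L}.
Proof.
move=> Cf; pose g := linfun (@code_coord F L E e).
have -> : vanishing C [set e] = (C :&: lker g)%VS.
  apply/vspaceP => c; rewrite mem_vanishing memv_cap memv_ker lfunE.
  congr (_ && _); apply/forall_inP/eqP => [c0|c0 f /set1P->]; last exact/eqP.
  by apply/eqP/c0; rewrite inE.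
have <- : (g @: C = fullv)%VS.
  apply/eqP; rewrite eqEsubv subvf; apply/subvP => x _.
  by have [c Cc <-] := Cf e x; apply/memv_imgP; exists c; rewrite ?lfunE.
by rewrite -(limg_ker_dim g C) addKn.
Qed.

(* A linear functional on L^A that vanishes on the projection of C to the     *)
(* coordinates in A is a dual word supported in A.                            *)
Lemma dual_distance_le_rank h (b : h.-tuple L) C A : basis_of {:L} b ->
  (\dim C - \dim (vanishing C A) < h * #|A|)%N ->
  (dual_distance b C <= enat #|A|)%E.
Proof.
move=> bL rkA; have dimL : \dim {:L} = h by rewrite -(size_basis bL).
pose P : pred E := fun e => e \in A; pose rho := linfun (@restrict F E L P).
have kerA : (C :&: lker rho)%VS = vanishing C A.
  apply/vspaceP => c; rewrite mem_vanishing memv_cap memv_ker lfunE.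
  congr (_ && _); apply/eqP/forall_inP => [/ffunP c0 e eA|c0].
    by have := c0 (exist P e eA); rewrite !ffunE /= => ->.
  by apply/ffunP => e; rewrite !ffunE; apply/eqP/c0/(valP e).
have: ~~ (fullv <= rho @: C)%VS.
  apply: contraTN rkA => /dimvS; rewrite dim_ffun card_sig dimL.
  by rewrite -(limg_ker_dim rho C) kerA addKn -leqNgt mulnC.
case/subvPn=> v _ /separating_functional[phi phiv phiC].
pose delta e j : {ffun {e | P e} -> L} :=
  [ffun s => if val s == e then b`_j else 0].
(* [x] is [phi] in coordinates: its entries are the values of [phi] on the words that are a basis
   element at [e] and 0 elsewhere. For [e] outside [A] such a word is 0. *)
pose x : {ffun E -> 'rV[F]_h} := [ffun e => \row_(j < h) phi (delta e j)].
have xP c : inner_product x (expansion b c) = phi (rho c).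
  have -> : rho c = \sum_e \sum_(j < h) coord b j (c e) *: delta e j.
    apply/ffunP => s; rewrite lfunE ffunE /= (coord_basis bL (memvf (c _))).
    rewrite sum_ffunE (bigD1 (val s)) //= [X in _ + X]big1 ?addr0.
      by rewrite sum_ffunE; apply: eq_bigr => j _; rewrite !ffunE eqxx.
    move=> e /negPf es; rewrite sum_ffunE big1 // => j _.
    by rewrite !ffunE eq_sym es scaler0.
  rewrite linear_sum; apply: eq_bigr => e _; rewrite linear_sum.
  by apply: eq_bigr => j _; rewrite linearZ /= !ffunE !mxE mulrC.
have x0 : x != 0.
  apply: contraNneq phiv => x0.
  have <- : rho [ffun e => if insub e is Some w then v w else 0] = v.
    by rewrite lfunE; apply: restrict_surj.
  rewrite -xP x0.
  by rewrite /inner_product big1 // => e _; rewrite big1 // => j _; rewrite ffunE mxE mul0r.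
apply: (@le_trans _ _ (enat (hweight x))).
  apply: min_weight_le => //; apply/forallP => c; apply/implyP => Cc.
  by rewrite xP phiC // memv_img.
rewrite enat_le; apply/subset_leq_card/subsetP => e; rewrite inE.
apply: contraNT => eA; apply/eqP/rowP => j; rewrite !ffunE !mxE.
have -> : delta e j = 0; last by rewrite linear0.
apply/ffunP => s; rewrite !ffunE; case: eqP => // se.
by move: (valP s); rewrite se /P (negPf eA).
Qed.

End AdditiveCode.

(** * The code of a hypergraph *)

Section HypergraphCode.
Variables (F : finFieldType) (L : fieldExtType F) (V E : finType).
Variables (H : hypergraph V E) (h : nat).
Variables (ord : E -> h.+1.-tuple V) (iota : {linear 'rV[F]_h -> L}).
Hypotheses (ordH : edge_ordering H ord) (iota_bij : bijective iota).

Local Notation Phi := (hcode_map ord iota).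
Local Notation C := (hypergraph_code ord iota).

Lemma mem_edge e v : reflect (exists i, v = tnth (ord e) i) (v \in H e).
Proof. by case: (ordH e) => _ <-; rewrite inE; apply: tnthP. Qed.

Lemma hcode_map_eq0 (a : {ffun V -> F^o}) e :
  reflect {in H e &, forall u v, a u = a v} (Phi a e == 0).
Proof.
have -> : (Phi a e == 0) = (\row_(j < h) (a (tnth (ord e) (lift ord0 j)) -
    a (tnth (ord e) ord0)) == 0).
  by rewrite ffunE -[in LHS](linear0 iota) (bij_eq iota_bij).
apply: (iffP eqP) => [/rowP a0 | ea]; last first.
  by apply/rowP => j; rewrite !mxE (ea _ (tnth (ord e) ord0)) ?subrr //;
     apply/mem_edge; eexists.
suff ae u : u \in H e -> a u = a (tnth (ord e) ord0) by move=> u v /ae-> /ae->.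
case/mem_edge=> i ->; case: (unliftP ord0 i) => [j ->|-> //].
by apply/eqP; rewrite -subr_eq0; have := a0 j; rewrite !mxE => ->.
Qed.

Lemma hcode_map_eq0P (a : {ffun V -> F^o}) : reflect
  (forall u v, hadj H setT u v -> a u = a v) (Phi a == 0).
Proof.
apply: (iffP eqP) => [/ffunP a0 u v /hadjP[e _ [ue ve]]|a0].
  apply: (@hcode_map_eq0 a e _) => //.
  by rewrite a0 ffunE.
apply/ffunP => e; rewrite [RHS]ffunE; apply/eqP/hcode_map_eq0 => u v ue ve.
by apply: a0; apply/hadjP; exists e; rewrite ?inE.
Qed.

(* Only the values of [a] on [H e] matter for [Phi a e], and at most one of   *)
(* them is tied to the value on [B].                                          *)
Lemma hcode_map_interp e (B : {set V}) (l : L) : (#|H e :&: B| <= 1)%N ->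
  exists2 a, Phi a e = l & {in B &, forall u v, a u = a v}.
Proof.
move=> eB; have [g _ iotaK] := iota_bij; pose p := g l.
(* The base vertex gets 0 and the others get the entries of [p], so the differences along [ord e]
   recover [p]. *)
pose val_ i := if unlift ord0 i is Some j then p 0 j else 0 : F.
pose f v := val_ (inord (index v (ord e))).
have fE i : f (tnth (ord e) i) = val_ i.
  by rewrite /f (tnth_nth (tnth (ord e) i)) index_uniq ?size_tuple ?inord_val //; case: (ordH e).
(* Outside the edge, [a] repeats its value at the vertex common to [H e] and [B], if there is one;
   this makes it constant on [B]. *)
pose a : {ffun V -> F^o} :=
  [ffun v => if v \in H e then f v else
             if [pick u in H e :&: B] is Some u then f u else 0].
exists a.
  rewrite ffunE -[RHS]iotaK; congr (iota _); apply/rowP => j; rewrite !mxE !ffunE.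
  have mem_tnth i : tnth (ord e) i \in H e by apply/mem_edge; eexists.
  by rewrite !mem_tnth !fE /val_ liftK unlift_none subr0.
suff aB v : v \in B -> a v = if [pick u in H e :&: B] is Some u then f u else 0.
  by move=> u v /aB -> /aB ->.
move=> vB; rewrite ffunE; case: ifP => // ve; case: pickP => [u uI|/(_ v)].
  by rewrite (card_le1_eqP eB u v) // inE ve.
by rewrite !inE ve vB.
Qed.

Lemma hypergraph_code_faithful : faithful_code C.
Proof.
move=> e l; have [|a <- _] := hcode_map_interp (e := e) (B := set0) l.
  by rewrite setI0 cards0.
by exists (Phi a) => //; apply/mem_hypergraph_code; exists a.
Qed.

Let W A := (linfun Phi @^-1: vanishing C A)%VS.

Let WP A (a : {ffun V -> F^o}) : reflect (forall u v, hadj H A u v -> a u = a v) (a \in W A).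
Proof.
rewrite -memv_preim lfunE mem_vanishing (introT (mem_hypergraph_code _ _ _)); last by exists a.
apply: (iffP forall_inP) => [a0 u v /hadjP[e /a0/hcode_map_eq0 ae []]|a0 e eA].
  exact: ae.
apply/hcode_map_eq0 => u v ue ve; apply: a0; apply/hadjP.
by exists e.
Qed.

(** Rank-nullity for [Phi] on [W A], the functions constant on the components of [A]; the kernel
    consists of those constant on the components of the whole hypergraph. *)
Lemma dim_vanishing_hypergraph_code A :
  (ncomponents H setT + \dim (vanishing C A) = ncomponents H A)%N.
Proof.
have dimW B : \dim (W B) = ncomponents H B.
  by apply: dim_invariant; [apply: hadj_connect_sym | apply: WP].
have -> : vanishing C A = (linfun Phi @: W A)%VS.
  by rewrite lpreimK //; apply/subvP => c; rewrite mem_vanishing => /andP[].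
rewrite -!dimW -(limg_ker_dim (linfun Phi) (W A)); congr (\dim _ + _)%N.
apply/vspaceP => a; rewrite memv_cap memv_ker lfunE.
apply/WP/andP => [a0|[_ /hcode_map_eq0P //]].
split; last exact/hcode_map_eq0P.
apply/WP => u v /hadjP[e _ uve]; apply: a0; apply/hadjP.
by exists e; rewrite ?inE.
Qed.

Lemma dim_hypergraph_code : (ncomponents H setT + \dim C = #|V|)%N.
Proof.
have <- : \dim (lker (linfun Phi)) = ncomponents H setT.
  apply: dim_invariant; first exact: hadj_connect_sym.
  by move=> a; rewrite memv_ker lfunE; apply: hcode_map_eq0P.
rewrite -[lker _]capfv limg_ker_dim dim_ffun.
by rewrite dimvf /= muln1.
Qed.

Lemma hypergraph_code_hypergraphic : hypergraphic_code H C.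
Proof.
split=> [e|A].
  have [c Cc ce] := hypergraph_code_faithful e 1.
  by exists c; rewrite // ce oner_eq0.
by rewrite /hrank -dim_vanishing_hypergraph_code -dim_hypergraph_code subnDl.
Qed.

Lemma min_distance_hypergraph_code : hconnected H ->
  min_distance C = edge_connectivity H.
Proof.
move=> Hc; apply/le_anti/andP; split.
  apply: edge_connectivity_ge => S /set0Pn[u uS] /properP[_ [v _ vS]].
  (* The indicator function of [S] is constant on every uncut edge. *)
  pose a : {ffun V -> F^o} := [ffun w => (w \in S)%:R].
  apply: (@le_trans _ _ (enat (hweight (Phi a)))).
    apply: min_weight_le; first by apply/mem_hypergraph_code; exists a.
    apply/hcode_map_eq0P => a0; have /eqP := connect_inv a0 (Hc u v).
    by rewrite !ffunE uS (negPf vS) oner_eq0.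
  rewrite enat_le; apply/subset_leq_card/subsetP => e; rewrite [e \in [set _ | _]]inE.
  apply: contraNT => ecut; apply/hcode_map_eq0 => x y xe ye; rewrite !ffunE.
  congr (_ : bool)%:R; apply/idP/idP => zS; apply: contraNT ecut => zNS; rewrite inE;
    apply/andP; split; apply/set0Pn.
  - by exists x; rewrite inE xe.
  - by exists y; rewrite !inE ye.
  - by exists y; rewrite inE ye.
  - by exists x; rewrite !inE xe.
apply: min_weight_ge => c /mem_hypergraph_code[a ->] a0.
have [e ae] : exists e, Phi a e != 0.
  apply/existsP; apply: contraNT a0 => /existsPn ae; apply/eqP/ffunP => e.
  by rewrite [RHS]ffunE; apply/eqP/negPn.
have : ~~ [forall u in H e, forall v in H e, a u == a v].
  apply: contraNN ae => /forall_inP ae; apply/hcode_map_eq0 => u v ue ve.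
  exact/eqP/(forall_inP (ae u ue)).
case/forall_inPn=> u ue /forall_inPn[v ve uv].
(* An edge cut by this level set carries two distinct values of [a], so it lies in the support of
   the codeword. *)
pose S := [set w | a w == a u].
apply: (@le_trans _ _ (enat #|cut H S|)).
  apply: edge_connectivity_le; first by apply/set0Pn; exists u; rewrite inE.
  by apply/properP; split; [apply: subsetT | exists v; rewrite ?inE // eq_sym].
rewrite enat_le; apply/subset_leq_card/subsetP => f; rewrite !inE.
case/andP=> /set0Pn[x /setIP[xf]] + /set0Pn[y /setIP[yf]]; rewrite !inE => ax.
by apply: contraNN => /hcode_map_eq0 af; rewrite -(af x y).
Qed.

(* A nonzero functional on the coordinate [e] is not cancelled by one on [f], *)
(* since some codeword vanishes at [f] and is prescribed at [e].              *)
Lemma dual_distance_linear_ge (b : h.-tuple L) : basis_of {:L} b ->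
  (forall e f, e != f -> (#|H e :&: H f| <= 1)%N) ->
  (enat 3 <= dual_distance b C)%E.
Proof.
move=> bL Hlin; apply: min_weight_ge => x /forallP xC x0; rewrite enat_le.
have [e xe] : exists e, x e != 0.
  apply/existsP; apply: contraNT x0 => /existsPn xe; apply/eqP/ffunP => e.
  by rewrite [RHS]ffunE; apply/eqP/negPn.
have [i xi] : exists i, x e 0 i != 0.
  apply/existsP; apply: contraNT xe => /existsPn xe; apply/eqP/rowP => i.
  by rewrite [RHS]mxE; apply/eqP/negPn.
rewrite ltnNge; apply: contraNN xi; rewrite /hweight (cardsD1 e) inE xe ltnS => w1.
have [B eB Bx] : exists2 B : {set V}, (#|H e :&: B| <= 1)%N &
    forall f, f != e -> x f != 0 -> H f \subset B.
  have [D0|[f]] := set_0Vmem ([set f | x f != 0] :\ e).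
    exists set0; first by rewrite setI0 cards0.
    by move=> f fe xf; move/setP/(_ f): D0; rewrite !inE fe xf.
  move=> fD; exists (H f); first by apply: Hlin; move: fD; rewrite !inE eq_sym => /andP[].
  move=> g ge xg; rewrite (card_le1_eqP w1 g f) //.
  by rewrite !inE ge.
(* Constancy on [B] kills the terms of the inner product away from [e], and the value at [e] singles
   out the entry [x e 0 i]. *)
have [a ae aB] := hcode_map_interp b`_i eB.
have /implyP/(_ _)/eqP := xC (Phi a).
rewrite (introT (mem_hypergraph_code _ _ _)); last by exists a.
move=> /(_ isT); rewrite /inner_product (bigD1 e) //= [X in _ + X]big1 => [|f fe].
  rewrite addr0 (bigD1 i) //= big1 => [|j ji].
    rewrite addr0 ffunE mxE ae coord_free ?(basis_free bL) // eqxx mulr1.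
    by move=> ->.
  by rewrite ffunE mxE ae coord_free ?(basis_free bL) // eq_sym (negPf ji) mulr0.
rewrite big1 // => j _; rewrite ffunE mxE.
have [->|xf] := eqVneq (x f) 0; first by rewrite mxE mul0r.
have /subsetP fB := Bx f fe xf.
have /eqP -> : Phi a f == 0.
  by apply/hcode_map_eq0 => u v /fB uB /fB vB; apply: aB.
by rewrite linear0 mulr0.
Qed.

End HypergraphCode.

(** * Linear hypergraphs and the bound on the dimension *)

Section Bound.
Variables (F : finFieldType) (L : fieldExtType F) (h : nat) (b : h.-tuple L).
Variables (V E : finType) (H : hypergraph V E) (C : {vspace {ffun E -> L}}).
Hypotheses (bL : basis_of {:L} b) (faithC : faithful_code C).
Hypotheses (hypC : hypergraphic_code H C) (connH : hconnected H).

(** The rank of a single edge is |e|-1, and faithfulness makes it the dimension of [L]. *)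
Lemma faithful_hypergraphic_uniform e : #|H e| = h.+1.
Proof.
have := hypC.2 [set e]; rewrite faithful_rank1 // hrank1 -(size_basis bL) => ->.
rewrite prednK // card_gt0; exact: ends_neq0.
Qed.

(** Two edges sharing two vertices cover at most 2h vertices, so their rank is at most 2h-1 and they
    carry a dual word of weight at most 2. *)
Lemma dual_distance_ge3_linear : (enat 3 <= dual_distance b C)%E ->
  forall e f, e != f -> (#|H e :&: H f| <= 1)%N.
Proof.
move=> d3 e f ef; rewrite leqNgt; apply/negP => eIf.
suff : (dual_distance b C <= enat 2)%E.
  by move/(le_trans d3); rewrite enat_le.
have <- : #|[set e; f]| = 2%N by rewrite cards2 ef.
apply: dual_distance_le_rank => //; rewrite hypC.2 cards2 ef.
apply: leq_ltn_trans (hrank_le (U := H e :|: H f) _ _) _.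
- by rewrite setU_eq0 negb_and ends_neq0.
- by move=> g /set2P[]->; rewrite ?subsetUl ?subsetUr.
have := subset_leq_card (subsetUl (H e) (H f)).
have := cardsUI (H e) (H f); rewrite !faithful_hypergraphic_uniform; lia.
Qed.

Lemma dim_connected_hypergraphic : \dim C = #|V|.-1.
Proof.
rewrite -(hrank_connected connH) -hypC.2.
suff -> : vanishing C setT = 0%VS by rewrite dimv0 subn0.
apply/eqP; rewrite -subv0; apply/subvP => c; rewrite mem_vanishing memv0.
case/andP=> _ /forall_inP c0; apply/eqP/ffunP => e; rewrite [RHS]ffunE.
by apply/eqP/c0; rewrite inE.
Qed.

(** The uncut edges have rank at most |V|-2, below the dimension |V|-1, so a nonzero codeword
    vanishes on all of them. *)
Lemma min_distance_le_cut S : S != set0 -> S \proper setT ->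
  (min_distance C <= enat #|cut H S|)%E.
Proof.
move=> S0 ST; have [u uS] := set0Pn _ S0.
have V1 : (1 < #|V|)%N.
  by have := proper_card ST; rewrite cardsT; apply: leq_trans; rewrite ltnS card_gt0.
have : vanishing C (~: cut H S) != 0%VS.
  rewrite -dimv_eq0 -lt0n -subn_gt0.
  have := hrank_cut H S0 ST; rewrite -hypC.2 dim_connected_hypergraphic; lia.
rewrite -vpick0; set c := vpick _ => c0.
have := memv_pick (vanishing C (~: cut H S)); rewrite mem_vanishing.
case/andP=> Cc /forall_inP cS; apply: (@le_trans _ _ (enat (hweight c))).
  exact: min_weight_le.
rewrite enat_le; apply/subset_leq_card/subsetP => e; rewrite [e \in [set _ | _]]inE.
by apply: contraNT => eS; apply: cS; rewrite inE.
Qed.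

Lemma hypergraphic_code_bound d : min_distance C = enat d ->
  (enat 3 <= dual_distance b C)%E -> (h * d <= \dim C)%N.
Proof.
move=> dC d3.
have h0 : (0 < h)%N.
  have := dim_vline (1 : L); rewrite oner_eq0 /= => <-.
  by rewrite -(size_basis bL) dimvS ?subvf.
(* With at most one vertex the code is 0 and its minimum distance infinite, contrary to [dC]. *)
have V1 : (1 < #|V|)%N.
  rewrite ltnNge; apply/negP => V1; move: dC.
  suff -> : min_distance C = +oo%E by [].
  apply/le_anti; rewrite leey /=; apply: min_weight_ge => c Cc.
  suff /eqP C0 : C == 0%VS by move: Cc; rewrite C0 memv0 => ->.
  by rewrite -dimv_eq0 dim_connected_hypergraphic -subn1 subn_eq0.
have [v _] := card_gt0P (ltnW V1).
have vT : [set v] \proper setT by rewrite properEcard subsetT cards1 cardsT.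
have Hunif := faithful_hypergraphic_uniform.
have := min_distance_le_cut (S := [set v]) _ vT.
rewrite -card_gt0 cards1 dC enat_le => /(_ isT) d_le.
rewrite dim_connected_hypergraphic.
apply: leq_trans (degree_linear v Hunif (dual_distance_ge3_linear d3)).
by rewrite leq_mul2l -(cut1 _ _) ?d_le ?orbT // => e; rewrite Hunif ltnS.
Qed.

End Bound.

Theorem corollary6p4 (N : nat) (V E : finType) (H : hypergraph V E)
    (N_ge7 : (7 <= N)%N) (cardV : #|V| = N)
    (stsH : steiner_triple_system H) :
  [/\ edge_connectivity H = ((N%:R - 1) / 2)%:E,
      (forall (F : finFieldType) (L : fieldExtType F) (b : 2.-tuple L)
          (ord : E -> 3.-tuple V) (iota : {linear 'rV[F]_2 -> L}),
        \dim {:L} = 2%N -> basis_of {:L} b ->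
        edge_ordering H ord -> bijective iota ->
        let C := hypergraph_code ord iota in
        [/\ additive_code_params C
              (N%:R * (N%:R - 1) / 6) ((N%:R - 1) / 2) ((N%:R - 1) / 2),
            dual_distance b C = enat 3,
            [/\ faithful_code C, hypergraphic_code H C & hconnected H]
          & enat (\dim C) = (2%:E * min_distance C)%E])
    & (forall (F : finFieldType) (L : fieldExtType F) (h : nat)
          (b : h.-tuple L) (V' E' : finType) (H' : hypergraph V' E')
          (C : {vspace {ffun E' -> L}}) (k d : nat),
        \dim {:L} = h -> basis_of {:L} b ->
        faithful_code C -> hypergraphic_code H' C -> hconnected H' ->
        \dim C = k -> min_distance C = enat d ->
        (enat 3 <= dual_distance b C)%E ->
        (h * d <= k)%N)].
Proof.
have V7 : (7 <= #|V|)%N by rewrite cardV.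
have [v _] := card_gt0P (leq_trans (isT : 0 < 7)%N V7).
set D := #|cut H [set v]|.
have DE : (2 * D = N.-1)%N by rewrite sts_degree // cardV.
have ND : N = (2 * D).+1 by rewrite DE prednK // (leq_trans _ N_ge7).
have halfN : (N%:R - 1) / 2 = D%:R :> rat.
  by rewrite ND -natr1 addrK natrM mulrC mulKf.
have conn : edge_connectivity H = enat D.
  by apply: sts_edge_connectivity => //; apply: leq_trans V7.
split; first by rewrite conn halfN.
- move=> F L b ord iota dimL bL ordH iota_bij C.
  have Hc := sts_connected stsH.
  have Cfaith : faithful_code C by apply: hypergraph_code_faithful ordH iota_bij.
  have Chyp : hypergraphic_code H C by apply: hypergraph_code_hypergraphic.
  have dimC : \dim C = (2 * D)%N.
    by rewrite (dim_connected_hypergraphic Chyp Hc) cardV DE.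
  have dC : min_distance C = enat D.
    by rewrite (min_distance_hypergraph_code ordH iota_bij Hc).
  split=> //; last by rewrite dimC dC /enat natrM EFinM.
    split; last by rewrite dC halfN.
      have := sts_card_edges stsH; rewrite cardV -DE.
      move=> /(congr1 (fun n => n%:R : rat)); rewrite !natrM -halfN.
      by rewrite [2 * _]mulrC divfK // => <-; rewrite mulrC mulKf.
    by rewrite dimC dimL halfN natrM mulrC mulKf.
  apply/le_anti/andP; split; last first.
    exact: (dual_distance_linear_ge ordH iota_bij bL (sts_linear stsH)).
  have [A A3 rkA] := sts_triangle stsH (leq_trans (isT : 3 < 7)%N V7).
  (* The rank is at most 5, below h|A| = 6. *)
  by rewrite -A3; apply: dual_distance_le_rank => //; rewrite Chyp.2 A3.
- move=> F L h b V' E' H' C k d _ bL Cf Ch Hc <-.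
  exact: hypergraphic_code_bound bL Cf Ch Hc _.
Qed.
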